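(* Let $\Phi$ be a Leonard system over $\mathbb F$ of type III$^-$, with eigenvalue sequence $\{\theta_i\}_{i=0}^d$, dual eigenvalue sequence $\{\theta^*_i\}_{i=0}^d$, and scalars $a,b,c,a^*,b^*,c^*\in\mathbb F$ with $c,c^*$ nonzero such that for $0\le i\le d$: $\theta_i=a+b+c(i-d/2)$ and $\theta^*_i=a^*+b^*+c^*(i-d/2)$ if $i$ is even; $\theta_i=a-b-c(i-d/2)$ and $\theta^*_i=a^*-b^*-c^*(i-d/2)$ if $i$ is odd. Let $\{\varphi_i\}_{i=1}^d$, $\{\phi_i\}_{i=1}^d$ be the first and second split sequences of $\Phi$, and let $t\in\overline{\mathbb F}$ be such that for $1\le i\le d$: $\varphi_i=\phi_i=cc^*i(d-i+1)$ if $i$ is even, and, if $i$ is odd, $$\varphi_i=t-2bb^*-2(bc^*+cb^* )\bigl(i-\tfrac{d+1}{2}\bigr)-cc^*\bigl(i-\tfrac{d+1}{2}\bigr)^2,$$ $$\phi_i=t+2bb^*+2(bc^*-cb^* )\bigl(i-\tfrac{d+1}{2}\bigr)-cc^*\bigl(i-\tfrac{d+1}{2}\bigr)^2.$$ Let $\psi\in\overline{\mathbb F}$ be a solution of $\psi^2=tcc^*+b^2c^{*2}+b^{*2}c^2$. Let $\hat P$ be the normalized Drinfel'd polynomial of $\Phi$. Then the roots of $\hat P$ are $$t+2\psi\bigl(i-\tfrac{d+1}{2}\bigr)+cc^*\bigl(i-\tfrac{d+1}{2}\bigr)^2\qquad(1\le i\le d,\ i\text{ odd}).$$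
   Context: Let $\mathbb F$ be a field, $\overline{\mathbb F}$ its algebraic closure, $V$ a vector space over $\mathbb F$ of finite positive dimension. A tridiagonal pair on $V$ is an ordered pair of $\mathbb F$-linear maps $A,A^*:V\to V$ ($A^*$ is just a name, not an adjoint) such that: (i) both are diagonalizable; (ii) the eigenspaces of $A$ can be ordered $V_0,\dots,V_d$ with $A^*V_i\subseteq V_{i-1}+V_i+V_{i+1}$ ($0\le i\le d$, $V_{-1}=V_{d+1}=0$); (iii) the eigenspaces of $A^*$ can be ordered $V^*_0,\dots,V^*_\delta$ with $AV^*_i\subseteq V^*_{i-1}+V^*_i+V^*_{i+1}$ ($0\le i\le\delta$, $V^*_{-1}=V^*_{\delta+1}=0$); (iv) no subspace $W\ne 0,V$ satisfies $AW\subseteq W$ and $A^*W\subseteq W$. It is known that $d=\delta$ (the diameter) and $\dim V_i=\dim V^*_i=\dim V_{d-i}$. Orderings as in (ii), (iii) are called standard. The pair is a Leonard pair if all $V_i$, $V_i^*$ have dimension 1. A tridiagonal system over $\mathbb F$ is a sequence $\Phi=(A;\{E_i\}_{i=0}^d;A^*;\{E^*_i\}_{i=0}^d)$ where $A,A^*$ is a tridiagonal pair and, for standard orderings of the eigenspaces, $E_i$ (resp. $E^*_i$) is the projection onto $V_i$ (resp. $V^*_i$) along the sum of the other eigenspaces. $\Phi$ is a Leonard system if $A,A^*$ is a Leonard pair. The eigenvalue sequence $\{\theta_i\}$ (dual eigenvalue sequence $\{\theta^*_i\}$) consists of the eigenvalues of $A$ on $E_iV$ (of $A^*$ on $E^*_iV$).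 For $\dim E^*_0V=1$, $E^*_0V$ is known to be invariant under $(A^*-\theta^*_1I)\cdots(A^*-\theta^*_iI)(A-\theta_{i-1}I)\cdots(A-\theta_0I)$ for $0\le i\le d$; $\zeta_i$ denotes the corresponding eigenvalue, and $\{\zeta_i\}_{i=0}^d$ is the split sequence of $\Phi$ ($\zeta_0=1$). Put $\Phi^\Downarrow=(A;\{E_{d-i}\}_{i=0}^d;A^*;\{E^*_i\}_{i=0}^d)$. For a Leonard system the split sequences of $\Phi$ and $\Phi^\Downarrow$ are known to have nonzero entries, and the first split sequence $\{\varphi_i\}_{i=1}^d$ (second split sequence $\{\phi_i\}_{i=1}^d$) is determined by the requirement that $\{\varphi_1\cdots\varphi_i\}_{i=0}^d$ (resp. $\{\phi_1\cdots\phi_i\}_{i=0}^d$) is the split sequence of $\Phi$ (resp. $\Phi^\Downarrow$). Base $\beta\in\mathbb F$: if $d\ge3$, the expressions $\frac{\theta_{i-2}-\theta_{i+1}}{\theta_{i-1}-\theta_i}$, $\frac{\theta^*_{i-2}-\theta^*_{i+1}}{\theta^*_{i-1}-\theta^*_i}$ are known to be equal and independent of $i$ for $2\le i\le d-1$, and $\beta+1$ is their common value; if $d\le2$, $\beta$ is any fixed nonzero scalar in $\mathbb F$. Type III$^-$ means $\beta=-2$, $\mathrm{Char}(\mathbb F)\ne2$ and $d$ is odd. For this type it is known that scalars $a,b,c,a^*,b^*,c^*$ as in the claim exist ($c,c^*$ are automatically nonzero when $d\ge2$, and are chosen nonzero when $d=1$), that $\mathrm{Char}(\mathbb F)$ is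 0 or an odd prime greater than $d/2$, and that (for a Leonard system) a scalar $t$ as in the claim exists. Normalized Drinfel'd polynomial (type III$^-$): $\hat P=\sum_{i=0}^d\zeta_i\,\hat p_{i+1}\hat p_{i+2}\cdots\hat p_d\in\mathbb F[\lambda]$, where for $1\le i\le d$, $\hat p_i=cc^*i^2$ if $i$ is even and $\hat p_i=2bb^*+2(bc^*+cb^* )(i-d)+cc^*(i-d)^2-\lambda$ if $i$ is odd. It has degree exactly $(d+1)/2$. *)

(* Defs.v *)
From HB Require Import structures.
From mathcomp Require Import all_boot all_order all_algebra.

Set Implicit Arguments.
Unset Strict Implicit.
Unset Printing Implicit Defensive.

Import GRing.Theory.
Local Open Scope ring_scope.

Section TridiagonalPairs.

Variables (F : fieldType) (V : vectType F).
Implicit Types (A As : 'End(V)) (U : nat -> {vspace V}).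

Definition diagonalizable_end A : Prop :=
  exists2 X : seq V, basis_of fullv X &
    forall v, v \in X -> exists a : F, A v = a *: v.

Definition is_eigenspace A (W : {vspace V}) : Prop :=
  exists2 a : F, passmx.leigenvalue A a & W = passmx.leigenspace A a.

(* Finite sequences are indexed by nat; only the indices 0, ..., d matter. *)
Definition eigenspace_ordering A (d : nat) U : Prop :=
  (forall i j, (i <= d)%N -> (j <= d)%N -> U i = U j -> i = j) /\
  (forall W, is_eigenspace A W <-> exists2 i, (i <= d)%N & W = U i).

(* The sum ranges over 0 <= j <= d with |i - j| <= 1, which builds in the
   convention that the spaces of index -1 and d + 1 are zero. *)
Definition standard_ordering A As (d : nat) U : Prop :=
  eigenspace_ordering A d U /\
  forall i, (i <= d)%N ->
    (As @: U i <= \sum_(j < d.+1 | (i <= j.+1)%N && (j <= i.+1)%N) U j)%VS.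

Definition tridiagonal_pair A As : Prop :=
  [/\ (0 < \dim {:V})%N,
      diagonalizable_end A /\ diagonalizable_end As,
      exists d U, standard_ordering A As d U,
      exists delta Us, standard_ordering As A delta Us
    & forall W : {vspace V}, (A @: W <= W)%VS -> (As @: W <= W)%VS ->
        W = 0%VS \/ W = fullv].

Definition leonard_pair A As : Prop :=
  [/\ tridiagonal_pair A As,
      forall W, is_eigenspace A W -> \dim W = 1%N
    & forall W, is_eigenspace As W -> \dim W = 1%N].

Definition eigenspace_projection (d : nat) U (i : nat) : 'End(V) :=
  daddv_pi (U i) (\sum_(j < d.+1 | j != i :> nat) U j)%VS.

(* The data (A; {E_i}_{i=0}^d; A*; {E*_i}_{i=0}^d). *)
Record tdsys_data := TDSysData {
  diam : nat;
  opA : 'End(V);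
  idemA : nat -> 'End(V);
  opAs : 'End(V);
  idemAs : nat -> 'End(V)
}.

Implicit Type Phi : tdsys_data.

Definition tridiagonal_system Phi : Prop :=
  let: d := diam Phi in
  tridiagonal_pair (opA Phi) (opAs Phi) /\
  exists U Us,
    [/\ standard_ordering (opA Phi) (opAs Phi) d U,
        standard_ordering (opAs Phi) (opA Phi) d Us,
        forall i, (i <= d)%N -> idemA Phi i = eigenspace_projection d U i
      & forall i, (i <= d)%N -> idemAs Phi i = eigenspace_projection d Us i].

Definition leonard_system Phi : Prop :=
  tridiagonal_system Phi /\ leonard_pair (opA Phi) (opAs Phi).

Definition Phi_Down Phi : tdsys_data :=
  TDSysData (diam Phi) (opA Phi) (fun i => idemA Phi (diam Phi - i)%N)
            (opAs Phi) (idemAs Phi).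

Definition eigenvalue_sequence Phi (theta : nat -> F) : Prop :=
  forall i, (i <= diam Phi)%N ->
    forall v, v \in limg (idemA Phi i) -> opA Phi v = theta i *: v.

Definition dual_eigenvalue_sequence Phi (thetas : nat -> F) : Prop :=
  forall i, (i <= diam Phi)%N ->
    forall v, v \in limg (idemAs Phi i) -> opAs Phi v = thetas i *: v.

(* (A - theta_{i-1} I) ... (A - theta_0 I) *)
Fixpoint lower_prod A (theta : nat -> F) (i : nat) : 'End(V) :=
  if i is k.+1 then ((A - theta k *: \1) \o lower_prod A theta k)%VF
  else \1%VF.

(* (A* - theta*_1 I) ... (A* - theta*_i I) *)
Fixpoint raise_prod As (thetas : nat -> F) (i : nat) : 'End(V) :=
  if i is k.+1 then (raise_prod As thetas k \o (As - thetas k.+1 *: \1))%VF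
  else \1%VF.

Definition split_sequence Phi (zeta : nat -> F) : Prop :=
  \dim (limg (idemAs Phi 0%N)) = 1%N /\
  exists theta thetas,
    [/\ eigenvalue_sequence Phi theta,
        dual_eigenvalue_sequence Phi thetas
      & forall i, (i <= diam Phi)%N ->
          forall v, v \in limg (idemAs Phi 0%N) ->
            (raise_prod (opAs Phi) thetas i \o lower_prod (opA Phi) theta i)%VF v
              = zeta i *: v].

(* phi 0 is unused: both sequences are indexed by 1, ..., d. *)
Definition first_split_sequence Phi (phi : nat -> F) : Prop :=
  split_sequence Phi (fun i => \prod_(1 <= j < i.+1) phi j).

Definition second_split_sequence Phi (phi : nat -> F) : Prop :=
  first_split_sequence (Phi_Down Phi) phi.

(* For diameter at most 2 the base is any fixed nonzero scalar. *)
Definition is_base Phi (beta : F) : Prop :=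
  if (3 <= diam Phi)%N then
    exists theta thetas,
      [/\ eigenvalue_sequence Phi theta,
          dual_eigenvalue_sequence Phi thetas
        & forall i, (2 <= i <= (diam Phi).-1)%N ->
            (theta (i - 2)%N - theta i.+1) / (theta i.-1 - theta i) = beta + 1 /\
            (thetas (i - 2)%N - thetas i.+1) / (thetas i.-1 - thetas i) = beta + 1]
  else beta != 0.

Definition type_III_minus Phi (beta : F) : Prop :=
  [/\ is_base Phi beta, beta = - 2%:R, 2 \notin [pchar F] & odd (diam Phi)].

End TridiagonalPairs.

Section DrinfeldPolynomial.

Variable F : fieldType.

Definition drinfeld_factor (d : nat) (b c bs cs : F) (i : nat) : {poly F} :=
  if odd i then
    (2%:R * b * bs + 2%:R * (b * cs + c * bs) * (i%:R - d%:R)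
       + c * cs * (i%:R - d%:R) ^+ 2)%:P - 'X
  else (c * cs * i%:R ^+ 2)%:P.

(* Type III^- normalization; zeta is the split sequence. *)
Definition normalized_drinfeld_poly (d : nat) (b c bs cs : F) (zeta : nat -> F)
    : {poly F} :=
  \sum_(0 <= i < d.+1)
    zeta i *: \prod_(i.+1 <= j < d.+1) drinfeld_factor d b c bs cs j.

End DrinfeldPolynomial.

(* L, with the embedding iota, is an algebraic closure of F. *)
Definition is_algebraic_closure (F : fieldType) (L : closedFieldType)
    (iota : {rmorphism F -> L}) : Prop :=
  forall x : L, algebraicOver iota x.

(* Main.v *)
Require Import Defs.
From HB Require Import structures.
From mathcomp Require Import all_boot all_order all_algebra.
From mathcomp Require Import ring zify.

Set Implicit Arguments.
Unset Strict Implicit.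
Unset Printing Implicit Defensive.

Import GRing.Theory.
Local Open Scope ring_scope.

(** The diameter is odd, d = 2n + 1; put N = n + 1 and h = c c*.  Since the
    split sequence of a system is unique, zeta_i = varphi_1 ... varphi_i, so
    the polynomial is an explicit sum over the cut point i of
    varphi_1 ... varphi_i p_(i+1) ... p_d.  The factors of even index are
    scalars, varphi_(2l) = 4hl (N - l) and p_(2l) = 4hl l: up to the common
    factor prod_l 4hl and n!, cutting them at k leaves the binomial 'C(n, k).
    The two cuts i = 2k and i = 2k + 1 share this binomial, and Pascal's rule
    turns the sum into (lemma [sum_cut_products])
      sum_k 'C(N, k) varphi_1 varphi_3 ... varphi_(2k-1) p_(2k+1) ... p_(2n+1).

    Let u = b c* + b* c and q(z) = z^2 - 2uz + 2h b b* - h X, a quadratic in z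
    whose constant term contains the indeterminate X.  With A = psi + u - hn,
    completing the square and inserting the equation for psi gives
      h p_(d-2l)       = q (2hl),
      h varphi_(2l+1)  = (A + 2hl) (A - 2u + 2h(n - l)),
      h (r_(2l+1) - X) = q (A + 2hl),
    r_i being the announced roots.  Hence the theorem is an instance of the
    Pfaff-Saalschutz summation (lemma [pfaff_saalschutz]), written in terms of
    the coefficients of q so that it applies in the polynomial ring itself and
    the square root of its discriminant is never needed.

    The remaining scalar is, up to sign, (4h)^n n!^2.  It is nonzero because
    the characteristic is not 2 and because, if l + 1 vanished in the field for
    some l < n, then theta_(2l+2) = theta_0, whereas the
    eigenvalues of a tridiagonal system are distinct (lemma
    [eigenvalue_sequence_inj]). *)

(** * The Pfaff-Saalschutz summation *)

Section Saalschutz.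
Variables (R : comNzRingType) (A s p e : R).

Let q (x : R) : R := x ^+ 2 - s * x + p.
Let rise (k : nat) : R := \prod_(l < k) (A + e * l%:R).
Let fall (N k : nat) : R := \prod_(l < k) (A - s + e * (N%:R - 1 - l%:R)).
Let node (k : nat) : R := \prod_(l < k) q (e * l%:R).
Let summand (N k : nat) : R := 'C(N, k)%:R * (rise k * fall N k * node (N - k)).

(* The certificate of the Wilf-Zeilberger method: as a function of k it
   telescopes the first-order recurrence in N satisfied by the summands. *)
Let certificate (N k : nat) : R :=
  if k is j.+1 then
    - ('C(N, j)%:R * (rise j.+1 * fall N j * node (N - j))
        * (A - s + e * N%:R + e * (N%:R - j%:R)))
  else 0.

Let fallS N k : fall N.+1 k.+1 = (A - s + e * N%:R) * fall N k.
Proof.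
rewrite /fall big_ord_recl /=; congr (_ * _); first by rewrite -[N.+1%:R]natr1; ring.
apply: eq_bigr => l _; rewrite /bump /= add1n -!natr1; ring.
Qed.

Let summand_step N k : (k <= N.+1)%N ->
  summand N.+1 k - q (A + e * N%:R) * summand N k
  = certificate N k.+1 - certificate N k.
Proof.
case: k => [_|j].
  rewrite /summand /certificate !bin0 !subn0 /rise /fall big_ord0 !big_ord0.
  rewrite big_ord_recr /= big_ord0 /node big_ord_recr /= /q.
  ring.
rewrite ltnS leq_eqVlt => /predU1P[->|lt_jN].
  rewrite /summand /certificate binn bin_small // binn !subnn fallS.
  by rewrite /node big_ord0; ring.
have [m Nm] : exists m, N = (j + m.+1)%N by exists (N - j).-1; lia.
have riseS : rise j.+2 = rise j.+1 * (A + e * j.+1%:R).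
  by rewrite /rise big_ord_recr.
have fallSr : fall N j.+1 = fall N j * (A - s + e * (N%:R - 1 - j%:R)).
  by rewrite /fall big_ord_recr.
have nodeS : node m.+1 = node m * q (e * m%:R) by rewrite /node big_ord_recr.
rewrite /summand /certificate fallS riseS fallSr subSS.
have -> : (N - j = m.+1)%N by lia.
have -> : (N - j.+1 = m)%N by lia.
have bin_rel : j.+1%:R * 'C(N, j.+1)%:R = m.+1%:R * 'C(N, j)%:R :> R.
  by rewrite -!natrM mul_bin_left; congr (_ * _)%:R; lia.
rewrite nodeS binS natrD.
have NR : N%:R = j%:R + m%:R + 1 :> R by rewrite Nm addnS -natr1 natrD.
apply/eqP; rewrite -subr_eq0; apply/eqP.
move: (rise _) (fall _ _) (node _) ('C(N, j.+1)%:R) ('C(N, j)%:R) bin_rel.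
move=> X Y Z b1 b0 bin_rel.
(* The difference of the two sides is a multiple of the binomial relation. *)
transitivity (X * Y * Z * q (e * m%:R) * e * (j.+1%:R * b1 - m.+1%:R * b0)).
  by rewrite NR /q -!natr1; ring.
by rewrite bin_rel subrr mulr0.
Qed.

(** If q(z) = (z - C)(z - D), this is the summation of the balanced
    terminating 3F2 series with parameters A, A - C - D + (N-1)e and step e.
    Only the coefficients s = C + D and p = CD occur, so the roots of q need
    not exist in R.  Both sides satisfy
    S(N + 1) = q(A + eN) S(N): for the sum this is [summand_step] summed
    over k. *)
Lemma pfaff_saalschutz N :
  \sum_(k < N.+1) 'C(N, k)%:R
     * (\prod_(l < k) ((A + e * l%:R) * (A - s + e * (N%:R - 1 - l%:R)))
        * \prod_(l < N - k) ((e * l%:R) ^+ 2 - s * (e * l%:R) + p))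
  = \prod_(l < N) ((A + e * l%:R) ^+ 2 - s * (A + e * l%:R) + p).
Proof.
under eq_bigr => k _ do rewrite big_split /=.
rewrite -/(\sum_(k < N.+1) summand N k).
elim: N => [|N IHN].
  by rewrite big_ord_recr /= !big_ord0 /summand /rise /fall /node !big_ord0 bin0; ring.
rewrite [RHS]big_ord_recr /= -IHN.
have -> : \sum_(k < N.+1) summand N k = \sum_(0 <= k < N.+2) summand N k.
  (* The added summand k = N + 1 is zero; it makes both sums range alike. *)
  by rewrite big_mkord [RHS]big_ord_recr /= [X in _ + X]/summand bin_small // mul0r addr0.
rewrite -(big_mkord xpredT) mulrC mulr_sumr.
apply/eqP; rewrite -subr_eq0 -sumrB.
under eq_big_nat => k /andP[_ lek] do rewrite summand_step //.
by rewrite telescope_sumr // /certificate bin_small // !mul0r !oppr0 addr0.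
Qed.

End Saalschutz.

(** * Separating odd and even indices *)

Lemma big_nat_pairs (R : Type) (idx : R) (op : Monoid.law idx) (f : nat -> R) m n :
  \big[op/idx]_(m.*2 <= i < n.*2) f i
  = \big[op/idx]_(m <= l < n) op (f l.*2) (f l.*2.+1).
Proof.
have [le_nm|lt_mn] := leqP n m.
  by rewrite !big_geq // leq_double.
elim: n lt_mn => // n IHn; rewrite ltnS => le_mn.
rewrite doubleS !big_nat_recr ?leq_double //=; last by rewrite leqW ?leq_double.
rewrite -Monoid.mulmA; congr (op _ _).
by move: le_mn; rewrite leq_eqVlt => /predU1P[->|/IHn//]; rewrite !big_geq.
Qed.

Lemma prod_falling_rising_bin n k : (k <= n)%N ->
  (\prod_(0 <= l < k) (n - l) * \prod_(k <= l < n) l.+1 = n`! * 'C(n, k))%N.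
Proof.
elim: k => [_|k IHk lt_kn].
  by rewrite big_geq // mul1n bin0 muln1 fact_prod big_add1.
apply/eqP; rewrite -(eqn_pmul2l (ltn0Sn k)); apply/eqP.
rewrite [RHS]mulnCA mul_bin_left [RHS]mulnCA -IHk 1?ltnW // big_nat_recr //=.
rewrite [\prod_(k <= l < n) _]big_ltn // mulnCA -!mulnA.
by rewrite mulnCA; congr (_ * _)%N; rewrite mulnCA.
Qed.

Section Pairing.
Variable R : comNzRingType.

(** Pascal's rule, as the effect of merging consecutive terms. *)
Lemma sum_pascal (G : nat -> R) n :
  \sum_(0 <= k < n.+1) 'C(n, k)%:R * (G k + G k.+1)
  = \sum_(k < n.+2) 'C(n.+1, k)%:R * G k.
Proof.
under eq_bigr => k _ do rewrite mulrDr.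
rewrite big_split /=.
have -> : \sum_(0 <= k < n.+1) 'C(n, k)%:R * G k
          = G 0%N + \sum_(0 <= k < n.+1) 'C(n, k.+1)%:R * G k.+1.
  by rewrite big_nat_recl // [in RHS]big_nat_recr //= bin0 mul1r bin_small // mul0r addr0.
rewrite -addrA -big_split /= big_ord_recl bin0 mul1r; congr (_ + _); rewrite big_mkord.
by apply: eq_bigr => k _; rewrite -mulrDl -natrD -binS.
Qed.

(** The sum over all cut points i of w_1 ... w_i p_(i+1) ... p_(2n+1).  The
    factors of even index are explicit enough to contribute just a binomial,
    the same one for i = 2k and i = 2k + 1; the last product of the right-hand
    side lists the p of odd index downwards, from 2n + 1 to 2k + 1. *)
Lemma sum_cut_products (w p g : nat -> R) n :
  (forall l, (l < n)%N -> w l.*2.+2 = g l * (n - l)%:R) ->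
  (forall l, (l < n)%N -> p l.*2.+2 = g l * l.+1%:R) ->
  \sum_(0 <= i < n.+1.*2) \prod_(1 <= j < i.+1) w j * \prod_(i.+1 <= j < n.+1.*2) p j
  = (\prod_(0 <= l < n) g l) * n`!%:R
    * \sum_(k < n.+2) 'C(n.+1, k)%:R
        * (\prod_(l < k) w l.*2.+1 * \prod_(l < n.+1 - k) p (n - l).*2.+1).
Proof.
move=> wE pE.
pose G k := \prod_(0 <= l < k) w l.*2.+1 * \prod_(k <= l < n.+1) p l.*2.+1.
transitivity ((\prod_(0 <= l < n) g l) * n`!%:R
    * \sum_(0 <= k < n.+1) 'C(n, k)%:R * (G k + G k.+1)); last first.
  rewrite sum_pascal; congr (_ * _); apply: eq_bigr => k _; congr (_ * _).
  by rewrite /G big_mkord big_rev_mkord.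
rewrite (big_nat_pairs _ _ 0) mulr_sumr; apply: eq_big_nat => k /andP[_]; rewrite ltnS => le_kn.
have wsplit : \prod_(1 <= j < k.*2.+1) w j
    = \prod_(0 <= l < k) w l.*2.+1
      * (\prod_(0 <= l < k) g l * \prod_(0 <= l < k) (n - l)%:R).
  rewrite big_add1 (big_nat_pairs _ _ 0) -!big_split /=.
  by apply: eq_big_nat => l /andP[_ lt_lk]; rewrite wE ?(leq_trans lt_lk).
have psplit : \prod_(k.*2.+2 <= j < n.+1.*2) p j
    = \prod_(k <= l < n) g l * \prod_(k <= l < n) l.+1%:R
      * \prod_(k <= l < n) p l.+1.*2.+1.
  rewrite -doubleS big_nat_pairs big_add1 -!big_split /=.
  by apply: eq_big_nat => l /andP[_ lt_ln]; rewrite doubleS pE.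
have Pk : \prod_(k <= l < n.+1) p l.*2.+1
          = p k.*2.+1 * \prod_(k <= l < n) p l.+1.*2.+1.
  by rewrite big_ltn // big_add1.
have Pk1 : \prod_(k.+1 <= l < n.+1) p l.*2.+1 = \prod_(k <= l < n) p l.+1.*2.+1.
  by rewrite big_add1.
have numE : \prod_(0 <= l < k) (n - l)%:R * \prod_(k <= l < n) l.+1%:R
            = n`!%:R * 'C(n, k)%:R :> R.
  by rewrite -!natr_prod -!natrM prod_falling_rising_bin.
rewrite [\prod_(1 <= j < k.*2.+2) w j]big_nat_recr //= wsplit.
rewrite [\prod_(k.*2.+1 <= j < _) p j]big_ltn ?ltn_Sdouble // psplit.
rewrite /G Pk Pk1 [\prod_(0 <= l < k.+1) _]big_nat_recr //=.
rewrite [RHS]mulrA -[_ * n`!%:R * _]mulrA -numE.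
rewrite [\prod_(0 <= l < n) g l](big_cat_nat _ (n := k)) //=.
ring.
Qed.

End Pairing.

(** * Eigenvalues and split sequences of a tridiagonal system *)

Section Eigenspaces.
Variables (F : fieldType) (V : vectType F).
Implicit Types (A : 'End(V)) (U : nat -> {vspace V}).

Lemma scaler_injr (x y : F) (v : V) : v != 0 -> x *: v = y *: v -> x = y.
Proof.
move=> v_neq0 /eqP; rewrite -subr_eq0 -scalerBl scaler_eq0 (negPf v_neq0) orbF.
by rewrite subr_eq0 => /eqP.
Qed.

Lemma memv_leigenspace A x v : (v \in passmx.leigenspace A x) = (A v == x *: v).
Proof. by rewrite memv_ker !lfun_simp /= subr_eq0. Qed.

(** Applying A - y kills the y-component and multiplies v by x - y, which
    shortens the list of eigenvalues by one. *)
Lemma leigenspace_disjoint_sum A x (s : seq F) v :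
  x \notin s -> v \in passmx.leigenspace A x ->
  v \in (\sum_(y <- s) passmx.leigenspace A y)%VS -> v = 0.
Proof.
elim: s v => [|y s IHs] v; first by rewrite big_nil memv0 => _ _ /eqP.
rewrite inE negb_or => /andP[neq_xy xNs] vx; rewrite big_cons.
case/memv_addP => u uy [w ws v_uw].
have xyv : (x - y) *: v = A w - y *: w.
  move: vx uy; rewrite !memv_leigenspace => /eqP vx /eqP uy.
  by rewrite scalerBl -vx v_uw linearD /= uy scalerDr opprD addrACA subrr add0r.
have sA z : z \in (\sum_(y <- s) passmx.leigenspace A y)%VS ->
            A z \in (\sum_(y <- s) passmx.leigenspace A y)%VS.
  elim: s z {IHs xNs ws} => [|t s IHs] z.
    by rewrite big_nil memv0 => /eqP->; rewrite linear0 mem0v.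
  rewrite big_cons => /memv_addP[z1 z1t [z2 z2s ->]]; rewrite linearD /=.
  apply: memv_add (IHs _ z2s); rewrite (eqP (_ : A z1 == t *: z1)) ?memvZ //.
  by rewrite -memv_leigenspace.
have /eqP : (x - y) *: v = 0.
  by apply: IHs => //; [rewrite memvZ | rewrite xyv memvB ?memvZ ?sA].
by rewrite scaler_eq0 subr_eq0 (negPf neq_xy) => /eqP.
Qed.

(** [daddv_pi] is a projection onto its first argument only when the two
    subspaces meet trivially, which holds here because eigenspaces for distinct
    eigenvalues are independent. *)
Lemma limg_eigenspace_projection A d U i :
  eigenspace_ordering A d U -> (i <= d)%N ->
  limg (eigenspace_projection d U i) = U i.
Proof.
move=> [Uinj Ueig] le_id.
have evP (j : 'I_d.+1) : exists x, U j = passmx.leigenspace A x.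
  have [|x _ ->] := (Ueig (U j)).2; last by exists x.
  by exists j => //; rewrite -ltnS.
have [ev evE] := fin_all_exists evP.
have [x Ux] : exists x, U i = passmx.leigenspace A x := evP (Ordinal (le_id : i < d.+1)%N).
apply/eqP; rewrite eqEsubv; apply/andP; split; apply/subvP => v.
  by case/memv_imgP => w _ ->; apply: memv_pi.
move=> vU; rewrite -[v](@daddv_pi_id _ _ (U i) (\sum_(j < d.+1 | j != i :> nat) U j)%VS) //.
  by rewrite memv_img ?memvf.
apply/eqP; rewrite -subv0; apply/subvP => w; rewrite memv_cap memv0.
case/andP => wUi wS; apply/eqP.
apply: (@leigenspace_disjoint_sum A x [seq ev j | j : 'I_d.+1 <- enum [pred j : 'I_d.+1| j != i :> nat]]).
- apply/mapP => -[j]; rewrite mem_enum inE => neq_ji xE.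
  by move: neq_ji; rewrite (Uinj j i) ?eqxx -1?ltnS // Ux evE xE.
- by rewrite -Ux.
- by rewrite big_map big_enum /=; under eq_bigr do rewrite -evE.
Qed.

Lemma eigenspace_ordering_neq0 A d U i :
  eigenspace_ordering A d U -> (i <= d)%N -> U i != 0%VS.
Proof.
move=> [_ Ueig] le_id.
by have [|x + ->] := (Ueig (U i)).2; first by exists i.
Qed.

(** U i is the eigenspace of some scalar, and that scalar must be x because
    U i is nonzero. *)
Lemma eigenspace_orderingE A d U i x :
  eigenspace_ordering A d U -> (i <= d)%N ->
  (forall v, v \in U i -> A v = x *: v) -> U i = passmx.leigenspace A x.
Proof.
move=> Uord le_id AU; have := eigenspace_ordering_neq0 Uord le_id.
have [|y _ Uy] := (Uord.2 (U i)).2; first by exists i.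
rewrite -vpick0; move: (vpick _) (memv_pick (U i)) => v vU v_neq0.
rewrite Uy; congr passmx.leigenspace; apply: (scaler_injr v_neq0).
by rewrite -AU //; move: vU; rewrite Uy memv_leigenspace => /eqP.
Qed.

Lemma eq_lower_prod A theta theta' i :
  (forall j, (j < i)%N -> theta j = theta' j) ->
  lower_prod A theta i = lower_prod A theta' i.
Proof.
elim: i => //= i IHi eq_th; rewrite eq_th // IHi // => j lt_ji.
by rewrite eq_th // ltnW.
Qed.

Lemma eq_raise_prod A theta theta' i :
  (forall j, (0 < j <= i)%N -> theta j = theta' j) ->
  raise_prod A theta i = raise_prod A theta' i.
Proof.
elim: i => //= i IHi eq_th; rewrite eq_th ?leqnn // IHi // => j /andP[j_gt0 le_ji].
by rewrite eq_th // j_gt0 leqW.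
Qed.

End Eigenspaces.

Section TridiagonalSystems.
Variables (F : fieldType) (V : vectType F) (Phi : tdsys_data V).
Hypothesis tdPhi : tridiagonal_system Phi.

Lemma eigenvalue_sequence_inj theta i j :
  eigenvalue_sequence Phi theta -> (i <= diam Phi)%N -> (j <= diam Phi)%N ->
  theta i = theta j -> i = j.
Proof.
have [_ [U [Us [[Uord _] _ idE _]]]] := tdPhi => thP le_i le_j eq_th.
have UE k : (k <= diam Phi)%N -> U k = passmx.leigenspace (opA Phi) (theta k).
  move=> le_k; apply: (eigenspace_orderingE Uord le_k) => v vU.
  by apply: thP => //; rewrite idE // (limg_eigenspace_projection Uord).
by apply: Uord.1 => //; rewrite !UE // eq_th.
Qed.

Lemma eigenvalue_sequence_unique theta theta' i :
  eigenvalue_sequence Phi theta -> eigenvalue_sequence Phi theta' ->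
  (i <= diam Phi)%N -> theta i = theta' i.
Proof.
have [_ [U [Us [[Uord _] _ idE _]]]] := tdPhi => thP thP' le_i.
have := eigenspace_ordering_neq0 Uord le_i.
rewrite -(limg_eigenspace_projection Uord le_i) -idE // -vpick0.
move: (vpick _) (memv_pick (limg (idemA Phi i))) => v vU v_neq0.
by apply: (scaler_injr v_neq0); rewrite -(thP _ le_i _ vU) (thP' _ le_i _ vU).
Qed.

Lemma dual_eigenvalue_sequence_unique theta theta' i :
  dual_eigenvalue_sequence Phi theta -> dual_eigenvalue_sequence Phi theta' ->
  (i <= diam Phi)%N -> theta i = theta' i.
Proof.
have [_ [U [Us [_ [Uord _] _ idE]]]] := tdPhi => thP thP' le_i.
have := eigenspace_ordering_neq0 Uord le_i.
rewrite -(limg_eigenspace_projection Uord le_i) -idE // -vpick0.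
move: (vpick _) (memv_pick (limg (idemAs Phi i))) => v vU v_neq0.
by apply: (scaler_injr v_neq0); rewrite -(thP _ le_i _ vU) (thP' _ le_i _ vU).
Qed.

(** The operator defining the i-th entry involves the eigenvalues of index at
    most i only, and these are unique; it acts on a nonzero space by that
    entry. *)
Lemma split_sequence_unique zeta zeta' i :
  split_sequence Phi zeta -> split_sequence Phi zeta' ->
  (i <= diam Phi)%N -> zeta i = zeta' i.
Proof.
move=> [dim1 [th [ths [thP thsP zP]]]] [_ [th' [ths' [thP' thsP' zP']]]] le_i.
have : limg (idemAs Phi 0%N) != 0%VS by rewrite -dimv_eq0 dim1.
rewrite -vpick0; move: (vpick _) (memv_pick (limg (idemAs Phi 0%N))) => v vU v_neq0.
apply: (scaler_injr v_neq0).
rewrite -zP // -zP' //; congr (fun_of_lfun (_ \o _)%VF _).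
  apply: eq_raise_prod => j /andP[_ le_ji].
  by apply: dual_eigenvalue_sequence_unique => //; apply: leq_trans le_i.
apply: eq_lower_prod => j lt_ji.
by apply: eigenvalue_sequence_unique => //; apply: leq_trans le_i; apply: ltnW.
Qed.

End TridiagonalSystems.

(** * Factorization of the polynomial *)

Section Factorization.
Variables (L : fieldType) (n : nat) (b c bs cs t psi : L) (varphi : nat -> L).

Let h : L := c * cs.
(* The offset i - (d + 1)/2 at the odd index i = 2l + 1, where d = 2n + 1. *)
Let x (l : nat) : L := l.*2%:R - n%:R.

Hypothesis h_neq0 : c * cs != 0.
Hypothesis psi_sq :
  psi ^+ 2 = t * (c * cs) + b ^+ 2 * cs ^+ 2 + bs ^+ 2 * c ^+ 2.
Hypothesis varphi_even : forall l, (l < n)%N ->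
  varphi l.*2.+2 = c * cs * l.*2.+2%:R * (n - l).*2%:R.
Hypothesis varphi_odd : forall l, (l <= n)%N ->
  varphi l.*2.+1
  = t - 2%:R * b * bs - 2%:R * (b * cs + c * bs) * x l - c * cs * x l ^+ 2.

Let drinfeld_root (l : nat) : L := t + 2%:R * psi * x l + c * cs * x l ^+ 2.

(* The quadratic in z to which the summation is applied; the indeterminate is
   part of its constant term. *)
Let q (z : L) : {poly L} :=
  (z ^+ 2 - 2%:R * (b * cs + c * bs) * z + 2%:R * h * b * bs)%:P - h%:P * 'X.

Let q_factor l : (l <= n)%N ->
  h%:P * drinfeld_factor n.*2.+1 b c bs cs (n - l).*2.+1 = q (2%:R * h * l%:R).
Proof.
move=> le_ln; rewrite /drinfeld_factor /= odd_double /= /q mulrBr -polyCM.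
congr (_%:P - _); rewrite -!natr1 -!muln2 !natrM natrB // /h; ring.
Qed.

(* Chosen such that A + 2hl = psi + u + h x_l, with u = b c* + b* c. *)
Let A : L := psi + (b * cs + c * bs) - h * n%:R.

(* Completing the square, q (u + y) = y^2 - b^2 c*^2 - b*^2 c^2 - h X. *)
Let q_root l : q (A + 2%:R * h * l%:R) = h%:P * ((drinfeld_root l)%:P - 'X).
Proof.
rewrite /q mulrBr -polyCM; congr (_%:P - _).
have -> : (A + 2%:R * h * l%:R) ^+ 2
   - 2%:R * (b * cs + c * bs) * (A + 2%:R * h * l%:R) + 2%:R * h * b * bs
   = psi ^+ 2 + 2%:R * psi * h * x l + h ^+ 2 * x l ^+ 2
     - b ^+ 2 * cs ^+ 2 - bs ^+ 2 * c ^+ 2.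
  by rewrite /A /x -muln2 natrM /h; ring.
by rewrite psi_sq /drinfeld_root /h; ring.
Qed.

Let varphi_factor l : (l <= n)%N ->
  h * varphi l.*2.+1
  = (A + 2%:R * h * l%:R)
    * (A - 2%:R * (b * cs + c * bs) + 2%:R * h * (n.+1%:R - 1 - l%:R)).
Proof.
move=> le_ln; rewrite varphi_odd //.
transitivity (psi ^+ 2 - (b * cs + c * bs + h * x l) ^+ 2).
  by rewrite psi_sq /h; ring.
by rewrite /A /x -muln2 natrM -natr1 /h; ring.
Qed.

(** Multiplied by h^(n+1), the sum of the odd-indexed products becomes the
    left-hand side of [pfaff_saalschutz] over {poly L}, with step 2h. *)
Lemma normalized_drinfeld_poly_factor :
  normalized_drinfeld_poly n.*2.+1 b c bs cs (fun i => \prod_(1 <= j < i.+1) varphi j)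
  = ((-1) ^+ n.+1 * (\prod_(0 <= l < n) (4%:R * c * cs * l.+1%:R) * n`!%:R))
    *: \prod_(l < n.+1) ('X - (drinfeld_root l)%:P).
Proof.
rewrite /normalized_drinfeld_poly -[n.*2.+2]doubleS.
pose p := drinfeld_factor n.*2.+1 b c bs cs.
pose w j := (varphi j)%:P.
pose g l := (4%:R * c * cs * l.+1%:R)%:P : {poly L}.
transitivity (\sum_(0 <= i < n.+1.*2)
    \prod_(1 <= j < i.+1) w j * \prod_(i.+1 <= j < n.+1.*2) p j).
  by apply: eq_bigr => i _; rewrite -mul_polyC rmorph_prod.
rewrite (@sum_cut_products _ w p g); first last.
- move=> l lt_ln; rewrite /p /drinfeld_factor /= odd_double /= /g -polyC_natr -polyCM.
  by congr _%:P; rewrite -doubleS -muln2 natrM; ring.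
- move=> l lt_ln; rewrite /w varphi_even // /g -polyC_natr -polyCM.
  by congr _%:P; rewrite -doubleS -!muln2 !natrM; ring.
have hP_neq0 : h%:P != 0 :> {poly L} by rewrite polyC_eq0.
have -> : \sum_(k < n.+2) 'C(n.+1, k)%:R
      * (\prod_(l < k) w l.*2.+1 * \prod_(l < n.+1 - k) p (n - l).*2.+1)
    = \prod_(l < n.+1) ((drinfeld_root l)%:P - 'X).
  apply: (mulfI (expf_neq0 n.+1 hP_neq0)).
  transitivity (\prod_(l < n.+1) (h%:P * ((drinfeld_root l)%:P - 'X))); last first.
    by rewrite big_split /= prodr_const card_ord.
  under [RHS]eq_bigr => l _ do rewrite -q_root.
  transitivity (\prod_(l < n.+1) ((A%:P + (2%:R * h)%:P * l%:R) ^+ 2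
     - (2%:R * (b * cs + c * bs))%:P * (A%:P + (2%:R * h)%:P * l%:R)
     + ((2%:R * h * b * bs)%:P - h%:P * 'X))); last first.
    by apply: eq_bigr => l _; rewrite /q; ring.
  rewrite -pfaff_saalschutz mulr_sumr; apply: eq_bigr => -[k /= lt_kn] _.
  rewrite mulrCA; congr (_ * _).
  have -> : h%:P ^+ n.+1 = \prod_(l < k) h%:P * \prod_(l < n.+1 - k) h%:P.
    by rewrite !prodr_const !card_ord -exprD subnKC.
  rewrite mulrACA -!big_split /=; congr (_ * _); apply: eq_bigr => l _.
    have le_ln : (l <= n)%N by have := ltn_ord l; lia.
    by rewrite /w -polyCM varphi_factor //; ring.
  have le_ln : (l <= n)%N by have := ltn_ord l; lia.
  by rewrite /p q_factor // /q; ring.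
have -> : \prod_(l < n.+1) ((drinfeld_root l)%:P - 'X)
    = (-1) ^+ n.+1 * \prod_(l < n.+1) ('X - (drinfeld_root l)%:P).
  rewrite -[X in _ ^+ X * _]card_ord -prodr_const -big_split /=.
  by apply: eq_bigr => l _; rewrite mulN1r opprB.
rewrite -rmorph_prod -mul_polyC !polyCM polyC_natr rmorphXn rmorphN1.
ring.
Qed.

End Factorization.

Lemma map_normalized_drinfeld_poly (F L : fieldType) (iota : {rmorphism F -> L})
    d b c bs cs zeta :
  map_poly iota (normalized_drinfeld_poly d b c bs cs zeta)
  = normalized_drinfeld_poly d (iota b) (iota c) (iota bs) (iota cs) (iota \o zeta).
Proof.
rewrite /normalized_drinfeld_poly rmorph_sum; apply: eq_bigr => i _.
rewrite /= map_polyZ rmorph_prod; congr (_ *: _); apply: eq_bigr => j _.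
rewrite /drinfeld_factor; case: odd.
  by rewrite rmorphB /= map_polyC map_polyX /=; congr (_%:P - _); ring.
by rewrite /= map_polyC /=; congr _%:P; ring.
Qed.

Theorem proposition11p9 (F : fieldType) (L : closedFieldType)
    (iota : {rmorphism F -> L}) (hL : is_algebraic_closure iota)
    (V : vectType F) (Phi : tdsys_data V) (hPhi : leonard_system Phi)
    (beta : F) (htype : type_III_minus Phi beta)
    (d : nat) (hd : d = diam Phi)
    (theta thetas : nat -> F)
    (htheta : eigenvalue_sequence Phi theta)
    (hthetas : dual_eigenvalue_sequence Phi thetas)
    (a b c as_ bs cs : F) (hc : c != 0) (hcs : cs != 0)
    (hev : forall i, (i <= d)%N -> ~~ odd i ->
       theta i = a + b + c * (i%:R - d%:R / 2%:R) /\
       thetas i = as_ + bs + cs * (i%:R - d%:R / 2%:R))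
    (hod : forall i, (i <= d)%N -> odd i ->
       theta i = a - b - c * (i%:R - d%:R / 2%:R) /\
       thetas i = as_ - bs - cs * (i%:R - d%:R / 2%:R))
    (varphi phi : nat -> F)
    (hvarphi : first_split_sequence Phi varphi)
    (hphi : second_split_sequence Phi phi)
    (t : L)
    (hsplit_even : forall i, (1 <= i <= d)%N -> ~~ odd i ->
       varphi i = c * cs * i%:R * (d - i + 1)%:R /\
       phi i = c * cs * i%:R * (d - i + 1)%:R)
    (hsplit_odd : forall i, (1 <= i <= d)%N -> odd i ->
       iota (varphi i) =
         t - iota (2%:R * b * bs)
           - iota (2%:R * (b * cs + c * bs) * (i%:R - d.+1%:R / 2%:R))
           - iota (c * cs * (i%:R - d.+1%:R / 2%:R) ^+ 2) /\
       iota (phi i) =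
         t + iota (2%:R * b * bs)
           + iota (2%:R * (b * cs - c * bs) * (i%:R - d.+1%:R / 2%:R))
           - iota (c * cs * (i%:R - d.+1%:R / 2%:R) ^+ 2))
    (psi : L)
    (hpsi : psi ^+ 2 = t * iota (c * cs) + iota (b ^+ 2 * cs ^+ 2)
                         + iota (bs ^+ 2 * c ^+ 2))
    (zeta : nat -> F) (hzeta : split_sequence Phi zeta) :
  let P := map_poly iota (normalized_drinfeld_poly d b c bs cs zeta) in
  let r := fun i : nat =>
    t + 2%:R * psi * (i%:R - d.+1%:R / 2%:R)
      + iota (c * cs) * (i%:R - d.+1%:R / 2%:R) ^+ 2 in
  (forall x : L, root P x <-> exists2 i, (1 <= i <= d)%N && odd i & x = r i) /\
  P %= \prod_(1 <= i < d.+1 | odd i) ('X - (r i)%:P).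
Proof.
move=> P r.
have [_ _ char2 odd_diam] := htype.
have two_neq0 : 2%:R != 0 :> F by move: char2; rewrite inE.
have two_neq0L : 2%:R != 0 :> L by rewrite -(rmorph_nat iota) fmorph_eq0.
have [n dE] : exists n, d = n.*2.+1.
  by exists d./2; rewrite -[LHS]odd_double_half hd odd_diam.
have half_d (K : fieldType) : 2%:R != 0 :> K -> d.+1%:R / 2%:R = n.+1%:R :> K.
  by move=> K2; rewrite dE -doubleS -muln2 natrM mulfK.
(* Otherwise theta (2l + 2) = theta 0. *)
have succ_neq0 l : (l < n)%N -> l.+1%:R != 0 :> F.
  move=> lt_ln; apply/eqP => l1_0.
  have le_d : (l.+1.*2 <= d)%N by rewrite dE; lia.
  have : l.+1.*2 = 0%N.
    apply: (eigenvalue_sequence_inj hPhi.1 htheta); rewrite -?hd //.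
    have [-> _] := hev _ le_d (etrans (congr1 negb (odd_double _)) erefl).
    have [-> _] := hev 0%N (leq0n _) erefl.
    by rewrite -muln2 natrM l1_0 mul0r.
  by [].
pose x l : L := l.*2%:R - n%:R.
have oddE l : l.*2.+1%:R - d.+1%:R / 2%:R = x l.
  by rewrite half_d // /x -!natr1; ring.
have oddEF l : iota (l.*2.+1%:R - d.+1%:R / 2%:R) = x l.
  by rewrite half_d // rmorphB !rmorph_nat /x -!natr1; ring.
have zetaE i : (i <= d)%N -> iota (zeta i) = \prod_(1 <= j < i.+1) iota (varphi j).
  move=> le_id; rewrite -rmorph_prod; congr (iota _).
  by rewrite hd in le_id; apply: (split_sequence_unique hPhi.1 hzeta hvarphi le_id).
have PE : P = normalized_drinfeld_poly d (iota b) (iota c) (iota bs) (iota cs)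
                (fun i => \prod_(1 <= j < i.+1) iota (varphi j)).
  rewrite /P map_normalized_drinfeld_poly; apply: eq_big_nat => i /andP[_ le_id].
  by rewrite /= zetaE.
have rootsE : \prod_(1 <= i < d.+1 | odd i) ('X - (r i)%:P)
    = \prod_(l < n.+1) ('X - (r l.*2.+1)%:P).
  (* Index 0 is added, with factor 1, so that the range splits into pairs. *)
  rewrite big_mkcond -[LHS]mul1r.
  rewrite -(@big_ltn _ _ _ 0 d.+1 (fun i => if odd i then 'X - (r i)%:P else 1)) //.
  rewrite dE -doubleS (big_nat_pairs _ _ 0 n.+1) big_mkord.
  by apply: eq_bigr => l _; rewrite /= odd_double /= mul1r.
have P_prod : P %= \prod_(1 <= i < d.+1 | odd i) ('X - (r i)%:P).
  rewrite rootsE PE [in X in X %= _]dE (normalized_drinfeld_poly_factor (t := t) (psi := psi)).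
  - rewrite [in X in _ %= X](eq_bigr (fun l : 'I_n.+1 => 'X - (t + 2%:R * psi * x l
      + iota c * iota cs * x l ^+ 2)%:P)); last first.
      by move=> l _; rewrite /r oddE rmorphM.
    apply: eqp_scale.
    rewrite mulf_neq0 ?signr_eq0 // mulf_neq0 //.
      rewrite prodf_seq_neq0; apply/allP => l; rewrite mem_index_iota => /andP[_ lt_ln].
      rewrite mulf_neq0 //; last by rewrite -(rmorph_nat iota) fmorph_eq0 succ_neq0.
      by rewrite !mulf_neq0 ?fmorph_eq0 // -[4%N]/(2 * 2)%N natrM mulf_neq0.
    rewrite fact_prod natr_prod prodf_seq_neq0; apply/allP => -[|l].
      by rewrite mem_index_iota.
    by rewrite mem_index_iota /= => lt_ln; rewrite -(rmorph_nat iota) fmorph_eq0 succ_neq0.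
  - by rewrite mulf_neq0 ?fmorph_eq0.
  - by rewrite hpsi; ring.
  - move=> l lt_ln.
    have [||-> _] := hsplit_even l.*2.+2; [by rewrite dE; lia | by rewrite /= odd_double |].
    by rewrite (_ : d - l.*2.+2 + 1 = (n - l).*2)%N; [ring | rewrite dE; lia].
  - move=> l le_ln.
    have [||-> _] := hsplit_odd l.*2.+1; [by rewrite dE; lia | by rewrite /= odd_double |].
    by rewrite !(rmorphM _ _ (_ - _)) [iota (c * cs * _)]rmorphM rmorphXn oddEF -/(x l); ring.
split=> // y; rewrite (eqp_root P_prod) rootE horner_prod prodf_seq_eq0.
split=> [/hasP[i] | [i /andP[i_bd i_odd] ->]].
  rewrite mem_index_iota => i_bd /andP[i_odd]; rewrite hornerXsubC subr_eq0 => /eqP->.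
  by exists i; rewrite // i_odd andbT.
apply/hasP; exists i; first by rewrite mem_index_iota.
by rewrite i_odd hornerXsubC subrr eqxx.
Qed.
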